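(* Let $0<\varepsilon<\frac{1}{2\sqrt2}$ and $M>0$, and let $E_0:\mathbb{R}^2\to\mathbb{R}$ and $u:[0,1]\to\mathbb{R}^2$ be the energy and curve defined in the context. Then for every $t\in(0,1]$, $$\frac{\mathrm d}{\mathrm dt}E_0(u(t))=-\bigl\langle \partial_t^{1/2}u(t),u'(t)\bigr\rangle=\frac{\Gamma(\frac32)}{2\sqrt t}\Bigl[\tfrac92\,t(1-t)-(1+\varepsilon^2)\Bigr].$$ Hence, for $t\in(0,1]$, $\frac{\mathrm d}{\mathrm dt}E_0(u(t))>0$ precisely when $$t\in(t_-,t_+),\qquad t_\pm=\frac12\Bigl(1\pm\sqrt{1-\tfrac{8(1+\varepsilon^2)}{9}}\Bigr),$$ and this interval is nonempty if and only if $\varepsilon<\frac{1}{2\sqrt2}$. The function $t\mapsto\frac{\mathrm d}{\mathrm dt}E_0(u(t))$ attains its global maximum on $(0,1]$ at $$t_*=\frac{9+\sqrt{81+216(1+\varepsilon^2)}}{54}.$$ For $\varepsilon=0.1$ one has (numerical values rounded to the displayed digits) $(t_-,t_+)\approx(0.34013895,\,0.65986105)$, $t_*\approx0.48696745$ and $\max_{0<t\le1}\frac{\mathrm d}{\mathrm dt}E_0(u(t))\approx0.07253820$. As $\varepsilon\downarrow0$, the endpoints $t_-$ and $t_+$ converge to $\frac13$ and $\frac23$, respectively.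
   Context: Caputo derivative of order $1/2$: for an absolutely continuous curve $v:[0,1]\to\mathbb{R}^2$, $\partial_t^{1/2}v(t):=\frac{1}{\Gamma(1/2)}\int_0^t (t-s)^{-1/2}v'(s)\,\mathrm ds$. For the curve $u$ below this is defined for every $t\in(0,1]$. The curve is $u(t)=\bigl(\varepsilon\sqrt t,\ \sqrt t\,(1-t)\bigr)$ for $t\in[0,1]$. The energy: for $(x,y)\in\mathbb{R}^2$ put $\zeta=x/\varepsilon$, $\psi(x)=\zeta-\zeta^3$, $w=y-\psi(x)$, $\Phi(\zeta)=\Gamma(\frac32)-\Gamma(\frac52)\zeta^2$, and let $B:\mathbb{R}\to\mathbb{R}$ be the unique function with $B(0)=0$ and $B'(x)=-\varepsilon\Gamma(\frac32)-\Phi(x/\varepsilon)\,\psi'(x)$ (here $\psi'$ is the derivative with respect to $x$). Then $$E_0(x,y)=B(x)-\Phi(\zeta)\,w+\tfrac M2 w^2 .$$ *)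

(* Defs.v *)
From mathcomp Require Import all_boot all_order all_algebra.
From mathcomp Require Import all_classical all_reals all_analysis.

Set Implicit Arguments.
Unset Strict Implicit.
Unset Printing Implicit Defensive.

Import Order.TTheory GRing.Theory Num.Theory.
Import numFieldNormedType.Exports.

Local Open Scope classical_set_scope.
Local Open Scope ring_scope.

Section Defs.
Variable R : realType.

Definition Gamma (a : R) : R :=
  \int[lebesgue_measure]_(s in `]0, +oo[) (s `^ (a - 1) * expR (- s)).

Definition inner (n : nat) (v w : 'rV[R]_n) : R := \sum_i v 0 i * w 0 i.

(* Caputo derivative of order 1/2. The integral is a Lebesgue integral, so the
   value of [v^`() s] on a null set where v is not differentiable, or of the
   kernel at [s = t], is irrelevant. *)
Definition caputo_integrand (n : nat) (v : R -> 'rV[R]_n) (t : R) (i : 'I_n)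
    (s : R) : R :=
  (t - s) `^ (- 2^-1) * v^`()%classic s 0 i.

Definition caputo_half (n : nat) (v : R -> 'rV[R]_n) (t : R) : 'rV[R]_n :=
  \row_i ((Gamma 2^-1)^-1 *
    \int[lebesgue_measure]_(s in `[0, t]) caputo_integrand v t i s).

(* Used on [0, 1]; the formula extends the curve to the whole line, so that
   its derivative at t = 1 is the one-sided derivative of the curve. *)
Definition curve (eps t : R) : 'rV[R]_2 :=
  \row_i [:: eps * Num.sqrt t; Num.sqrt t * (1 - t)]`_i.

Definition psi (eps x : R) : R := x / eps - (x / eps) ^+ 3.

Definition Phi (z : R) : R := Gamma (3 / 2) - Gamma (5 / 2) * z ^+ 2.

Definition is_B (eps : R) (B : R -> R) : Prop :=
  B 0 = 0 /\
  forall x : R, is_derive x 1 B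
    (- eps * Gamma (3 / 2) - Phi (x / eps) * (psi eps)^`()%classic x).

Definition B (eps : R) : R -> R := get [set f | is_B eps f].

Definition energy (eps M : R) (p : 'rV[R]_2) : R :=
  let x := p 0 0 in
  let y := p 0 1 in
  let w := y - psi eps x in
  B eps x - Phi (x / eps) * w + M / 2 * w ^+ 2.

Definition energy_on_curve (eps M t : R) : R := energy eps M (curve eps t).

(* When the discriminant is negative, [Num.sqrt] returns 0 and hence
   [t_minus = t_plus]: the open interval between them is empty. *)
Definition t_minus (eps : R) : R :=
  2^-1 * (1 - Num.sqrt (1 - 8 * (1 + eps ^+ 2) / 9)).

Definition t_plus (eps : R) : R :=
  2^-1 * (1 + Num.sqrt (1 - 8 * (1 + eps ^+ 2) / 9)).

Definition t_star (eps : R) : R :=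
  (9 + Num.sqrt (81 + 216 * (1 + eps ^+ 2))) / 54.

(* The number 0.d_1 d_2 ... d_n in base 10, for ds = [:: d_1; ...; d_n]. *)
Definition decimal (ds : seq nat) : R :=
  \sum_(i < size ds) (nth 0%N ds i)%:R / 10 ^+ i.+1.

(* Half a unit in the last displayed digit. *)
Definition rounds_to (x : R) (ds : seq nat) : Prop :=
  `|x - decimal ds| <= 2^-1 / 10 ^+ size ds.

End Defs.

(* Main.v *)
Require Import Defs.
From mathcomp Require Import all_boot all_order all_algebra.
From mathcomp Require Import all_classical all_reals all_analysis.
From mathcomp Require Import measurable_realfun ring lra.
Import Order.TTheory GRing.Theory Num.Theory.
Import numFieldNormedType.Exports.
Local Open Scope classical_set_scope.
Local Open Scope ring_scope.

Import gauss_integral_proof.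

(** On the curve x / eps = sqrt t and y = sqrt t - sqrt t ^ 3 = psi x, so w
    vanishes identically: both terms of the energy that contain w drop out and
    the energy along the curve is B (eps * sqrt t) ([energy_on_curveE]). Its
    derivative is given by the chain rule and the differential equation that
    defines B; with Gamma (5/2) = (3/2) Gamma (3/2) it takes the closed form
    called [rate] below ([is_derive_energy_on_curve]).

    The Caputo derivative of the curve needs only the two Abel integrals of
    1 / (2 sqrt s sqrt (t - s)) and sqrt s / sqrt (t - s) over ]0, t[, equal to
    pi / 2 and t * pi / 2. Their integrands are unbounded, but they have
    primitives built from atan (sqrt (s / (t - s))), and a nonnegative function
    with a primitive on an open interval integrates to the difference of the
    limits of the primitive at the two ends, by monotone convergence over
    closed subintervals ([ge0_FTC2_exhaustion]). The same principle gives the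
    values of Gamma: 2 times the integral of exp (- x ^ 2) over [0, sqrt s] is
    a primitive of s ^ (- 1/2) exp (- s), so that Gamma (1/2) = sqrt pi, and
    a * P s - s ^ a * exp (- s) raises the parameter of a primitive P by one.
    Comparing the inner product with the closed form then only uses
    pi = (sqrt pi) ^ 2 ([caputo_dissipation]).

    The sign of [rate] is the sign of a quadratic polynomial in t that is
    symmetric about 1/2 ([rate_gt0]). For the maximum put r = sqrt t and
    a = sqrt t_star. The equation 27 t_star ^ 2 - 9 t_star = 2 (1 + eps ^ 2)
    eliminates eps, and rate t_star - rate t becomes a positive multiple of
    (r - a) ^ 2 (r ^ 2 + 2 r a + 3 a ^ 2 - 1) / r, whose second factor is
    positive because 3 a ^ 2 = 3 t_star >= 1 ([rate_sqrt], [rate_le_t_star]).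

    The decimal values follow from bounds on square roots, obtained by
    squaring, and from bounds on pi to about 1e-7, obtained from Machin's
    formula and alternating Taylor bounds for atan ([pi_bounds]). *)

(** * Integration of a derivative over an open interval *)

(** Each closed interval falls under the usual fundamental theorem, and the
    integrals over the growing intervals converge to the integral over their
    union because f is nonnegative. Only points inside D occur, so f may blow up
    at the ends of D; integrability is part of the conclusion. *)
Lemma ge0_FTC2_exhaustion (R : realType) (f F : R -> R) (D : set R)
    (u v : R ^nat) (l m : R) :
  D = \bigcup_n `[u n, v n]%classic ->
  (forall n, u n < v n) -> nonincreasing_seq u -> nondecreasing_seq v ->
  (forall n x, x \in `[u n, v n] -> 0 <= f x) ->
  (forall n x, x \in `[u n, v n] -> is_derive x 1 F (f x)) ->
  (forall n x, x \in `[u n, v n] -> {for x, continuous f}) ->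
  F (u n) @[n --> \oo] --> l -> F (v n) @[n --> \oo] --> m ->
  (\int[lebesgue_measure]_(x in D) (f x)%:E = (m - l)%:E)%E.
Proof.
move=> -> uv du iv f0 dF cf Fu Fv.
have cfn n : {within `[u n, v n], continuous f}.
  by apply: continuous_in_subspaceT => x; rewrite inE/=; exact: cf.
have mf n : measurable_fun `[u n, v n] (EFin \o f).
  apply/measurable_EFinP; exact: subspace_continuous_measurable_fun.
have int_n n : (\int[lebesgue_measure]_(x in `[u n, v n]) (f x)%:E
    = (F (v n) - F (u n))%:E)%E.
  have cF : {within `[u n, v n], continuous F}.
    apply: derivable_within_continuous => x xuv.
    by have := dF n x xuv => ?; exact: ex_derive.
  rewrite (@continuous_FTC2 R f F)//.
  - have /(continuous_within_itvP _ (uv n))[_ ? ?] := cF.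
    split=> // x /subset_itv_oo_cc xuv.
    by have := dF n x xuv => ?; exact: ex_derive.
  - move=> x /subset_itv_oo_cc xuv; rewrite derive1E.
    by have := dF n x xuv => ?; exact: derive_val.
have ndI : nondecreasing_seq (fun n => `[u n, v n]%classic).
  move=> n k nk; rewrite subsetEset; apply: subset_itv; rewrite bnd_simp.
    exact: du.
  exact: iv.
have mI i : measurable (`[u i, v i]%classic : set R) by [].
have f0E i x : `[u i, v i]%classic x -> (0 <= (EFin \o f) x)%E.
  by move=> xi; rewrite lee_fin; exact: (f0 i).
have cvgI : (\int[lebesgue_measure]_(x in `[u n, v n]) (f x)%:E
      @[n --> \oo] -->
    \int[lebesgue_measure]_(x in \bigcup_n `[u n, v n]%classic) (f x)%:E)%E.
  by apply: ge0_nondecreasing_set_cvg_integral.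
have cvgF : (\int[lebesgue_measure]_(x in `[u n, v n]) (f x)%:E
      @[n --> \oo] -->
    (m - l)%:E)%E.
  rewrite (_ : (fun n => _) = EFin \o (fun n => F (v n) - F (u n))); last first.
    exact/funext.
  by apply: cvg_EFin; [exact: nearW|exact: cvgB].
by apply: (cvg_unique _ cvgI cvgF).
Qed.

(** The exhaustion starts at t / 3, so that every interval is nondegenerate. *)
Lemma itv0_bigcup (R : realType) (t : R) : 0 < t ->
  `]0, t[%classic = \bigcup_n `[t / n.+3%:R, t - t / n.+3%:R]%classic.
Proof.
move=> t0; apply/seteqP; split=> [x /=|x [n _] /=]; rewrite in_itv/=.
  move=> /andP[x0 xt].
  pose y := Num.min x (t - x).
  have y0 : 0 < y by rewrite /y lt_min x0 subr_gt0.
  have [n ny] : exists n : nat, t / y < n%:R.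
    by eexists; exact: truncnS_gt.
  have ty : t / n.+3%:R <= y.
    rewrite ler_pdivrMr// -ler_pdivrMl// mulrC ltW//.
    by rewrite (lt_le_trans ny)// ler_nat -addn3 leq_addr.
  exists n => //=; rewrite in_itv/=.
  move: ty; rewrite le_min => /andP[-> ?]/=.
  by rewrite lerBrDr addrC -lerBrDr.
rewrite in_itv/= => /andP[tx xt].
have tn : 0 < t / n.+3%:R by rewrite divr_gt0.
by rewrite (lt_le_trans tn tx)/= (le_lt_trans xt)// ltrBlDr ltrDl.
Qed.

Lemma itv0y_bigcup (R : realType) :
  `]0, +oo[%classic = \bigcup_n `[n.+2%:R ^- 2 : R, n.+2%:R ^+ 2]%classic.
Proof.
apply/seteqP; split=> [x /=|x [n _] /=]; rewrite in_itv/= ?andbT.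
  move=> x0.
  pose y := Num.max x x^-1.
  have [n ny] : exists n : nat, y < n%:R by eexists; exact: truncnS_gt.
  have yn : y <= n.+2%:R ^+ 2.
    rewrite (le_trans (ltW ny))//.
    have nn : n%:R <= n.+2%:R :> R by rewrite ler_nat -addn2 leq_addr.
    by rewrite (le_trans nn)// ler_eXnr// ler1n.
  move: yn; rewrite ge_max => /andP[xn xVn].
  exists n => //=; rewrite in_itv/= xn andbT.
  by rewrite -[leRHS]invrK lef_pV2// posrE ?exprn_gt0// invr_gt0.
rewrite in_itv/= => /andP[xn _]; rewrite (lt_le_trans _ xn)//.
Qed.

Lemma cvgn_natVr (R : realType) (p : nat) : (n + p)%:R^-1 @[n --> \oo] --> (0 : R).
Proof.
rewrite (cvg_shiftn p (fun n => n%:R^-1 : R)) -(cvg_shiftn 1)/=.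
by under eq_fun do rewrite addn1; exact: cvg_harmonic.
Qed.

Lemma ge0_FTC2_itv0y (R : realType) (f F : R -> R) (l m : R) :
  (forall x : R, 0 < x -> 0 <= f x) ->
  (forall x : R, 0 < x -> is_derive x 1 F (f x)) ->
  (forall x : R, 0 < x -> {for x, continuous f}) ->
  F x @[x --> 0^'+] --> l -> F x @[x --> +oo] --> m ->
  (\int[lebesgue_measure]_(x in `]0%R, +oo[) (f x)%:E = (m - l)%:E)%E.
Proof.
move=> f0 dF cf Fl Fm.
have pos n (x : R) : x \in `[n.+2%:R ^- 2, n.+2%:R ^+ 2] -> 0 < x.
  rewrite in_itv/= => /andP[nx _]; rewrite (lt_le_trans _ nx)//.
have sq0 n : 0 < n.+2%:R ^+ 2 :> R by rewrite exprn_gt0.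
have mono (n k : nat) : (n <= k)%N -> n.+2%:R ^+ 2 <= k.+2%:R ^+ 2 :> R.
  by move=> nk; rewrite lerXn2r ?nnegrE// ler_nat !ltnS.
have dFn n (x : R) :
    x \in `[n.+2%:R ^- 2, n.+2%:R ^+ 2] -> is_derive x 1 F (f x).
  by move/pos; exact: dF.
refine (@ge0_FTC2_exhaustion R f F _ _ _ l m (itv0y_bigcup R) _ _ _ _ dFn _ _ _).
- move=> n; rewrite (@lt_trans _ _ 1)//.
    by rewrite invf_lt1// exprn_egt1// ltr1n.
  by rewrite exprn_egt1// ltr1n.
- by move=> n k nk; rewrite lef_pV2 ?posrE//; exact: mono.
- by move=> n k nk; exact: mono.
- by move=> n x xn; exact: f0 (pos n x xn).
- by move=> n x xn; exact: cf (pos n x xn).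
- move/cvg_at_rightP : Fl; apply; split=> [n|]; first by rewrite invr_gt0.
  rewrite -[X in _ --> X](expr0n R 2).
  under eq_fun do rewrite -exprVn -[_.+2]addn2.
  apply: (@cvg_comp _ _ _ _ (fun x : R => x ^+ 2) _ _ _ (cvgn_natVr R 2)).
  exact: exprn_continuous.
- suff h : (n.+2%:R : R) ^+ 2 @[n --> \oo] --> +oo by exact: (cvg_comp _ _ h Fm).
  apply/cvgryPge => A; near=> n.
  have An : A <= n%:R by near: n; exact: nbhs_infty_ger.
  have nn : n%:R <= n.+2%:R :> R by rewrite ler_nat -addn2 leq_addr.
  by rewrite (le_trans An)// (le_trans nn)// ler_eXnr// ler1n.
Unshelve. all: by end_near. Qed.

Lemma ge0_FTC2_itv0 (R : realType) (t : R) (f F : R -> R) (l m : R) : 0 < t ->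
  (forall x : R, x \in `]0, t[ -> 0 <= f x) ->
  (forall x : R, x \in `]0, t[ -> is_derive x 1 F (f x)) ->
  (forall x : R, x \in `]0, t[ -> {for x, continuous f}) ->
  F x @[x --> 0^'+] --> l -> F x @[x --> t^'-] --> m ->
  (\int[lebesgue_measure]_(x in `]0%R, t[) (f x)%:E = (m - l)%:E)%E.
Proof.
move=> t0 f0 dF cf Fl Fm.
have tn n : 0 < t / n.+3%:R by rewrite divr_gt0.
have pos n (x : R) : x \in `[t / n.+3%:R, t - t / n.+3%:R] -> x \in `]0, t[.
  rewrite !in_itv/= => /andP[nx xn]; rewrite (lt_le_trans _ nx)//=.
  by rewrite (le_lt_trans xn)// ltrBlDr ltrDl.
have mono (n k : nat) : (n <= k)%N -> t / k.+3%:R <= t / n.+3%:R.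
  by move=> nk; rewrite ler_pM2l// lef_pV2 ?posrE// ler_nat !ltnS.
have cvg0 : t / n.+3%:R @[n --> \oo] --> 0.
  rewrite -[X in _ --> X](mulr0 t).
  under eq_fun do rewrite -[_.+3]addn3.
  by apply: cvgMr; exact: cvgn_natVr.
have dFn n x : x \in `[t / n.+3%:R, t - t / n.+3%:R] -> is_derive x 1 F (f x).
  by move/pos; exact: dF.
refine (@ge0_FTC2_exhaustion R f F _ _ _ l m (itv0_bigcup R t t0)
  _ _ _ _ dFn _ _ _).
- move=> n; rewrite ltrBrDr -mulrDr gtr_pMr//.
  by rewrite [ltRHS](splitr 1) ltrD// div1r ltf_pV2 ?posrE// ltr_nat.
- by move=> n k nk; exact: mono.
- by move=> n k nk; rewrite lerB//; exact: mono.
- by move=> n x xn; exact: f0 (pos n x xn).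
- by move=> n x xn; exact: cf (pos n x xn).
- by move/cvg_at_rightP : Fl; apply; split.
- move/cvg_at_leftP : Fm; apply; split=> [n|]; first by rewrite ltrBlDr ltrDl.
  by rewrite -[X in _ --> X]subr0; apply: cvgB => //; exact: cvg_cst.
Qed.

Lemma is_derive_integral0_gauss (R : realType) (x : R) : 0 < x ->
  is_derive x 1 integral0_gauss (gauss_fun x).
Proof.
move=> x0.
have [] := @continuous_FTC1_closed R gauss_fun 0 x (x + 1).
- by rewrite ltrDl.
- apply: continuous_compact_integrable; first exact: segment_compact.
  by apply: continuous_subspaceT; exact: continuous_gauss_fun.
- by [].
- exact: continuous_gauss_fun.
- by rewrite derive1E => ? <-; exact: DeriveDef.
Qed.

Lemma cvg0_integral0_gauss (R : realType) : @integral0_gauss R x @[x --> 0] --> 0.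
Proof.
apply: (@parameterized_integral_cvg_left R 0 1 gauss_fun) => //.
apply: continuous_compact_integrable; first exact: segment_compact.
by apply: continuous_subspaceT; exact: continuous_gauss_fun.
Qed.

Lemma cvgy_integral0_gauss (R : realType) :
  @integral0_gauss R x @[x --> +oo] --> Num.sqrt pi / 2.
Proof.
have -> : Num.sqrt pi / 2 = Num.sqrt (pi / 4) :> R.
  rewrite sqrtrM ?pi_ge0// sqrtrV// (_ : 4 = 2 ^+ 2).
    by rewrite sqrtr_sqr ger0_norm.
  by rewrite expr2 -natrM.
rewrite (_ : integral0_gauss = Num.sqrt \o (fun x => integral0_gauss x ^+ 2)).
  by apply: cvg_comp (@cvg_integral0_gauss_sqr R) _; exact: sqrt_continuous.
by apply/funext => r /=; rewrite sqrtr_sqr ger0_norm ?integral0_gauss_ge0.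
Qed.

(** * The values of Gamma at half-integers *)

(** If a < n, one term of the exponential series bounds exp x below by
    x ^ (n + 1) / (n + 1)!, which leaves (n + 1)! / x. *)
Lemma cvgy_powR_expRN (R : realType) (a : R) :
  x `^ a * expR (- x) @[x --> +oo] --> 0.
Proof.
have [n an] : exists n : nat, a < n%:R by eexists; exact: truncnS_gt.
apply: (@squeeze_cvgr _ _ _ _ (cst 0) (fun x => n.+1`!%:R * x^-1)).
- near=> x.
  have x1 : 1 <= x by near: x; exact: nbhs_pinfty_ge.
  have x0 : 0 < x by rewrite (lt_le_trans _ x1).
  rewrite mulr_ge0 ?powR_ge0 ?expR_ge0//=.
  have xa : x `^ a <= x ^+ n by rewrite -powR_mulrn ?(ltW x0)// ler_powR// ltW.
  have ex : x ^+ n.+1 / n.+1`!%:R <= expR x.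
    by rewrite (le_trans _ (expR_ge1Dxn n (ltW x0)))// lerDr.
  rewrite expRN ler_pdivrMr ?expR_gt0// (le_trans xa)//.
  by rewrite mulrAC ler_pdivlMr// -exprSr mulrC -ler_pdivrMr// ltr0n fact_gt0.
- exact: cvg_cst.
- rewrite -[X in _ --> X](mulr0 n.+1`!%:R); apply: cvgMr.
  apply/gtr0_cvgV0; last exact: cvg_id.
  by near=> x; near: x; exact: nbhs_pinfty_gt.
Unshelve. all: by end_near. Qed.

(** Gamma is evaluated through explicit primitives of its integrand: the
    integrand is nonnegative, so the limits of a primitive at 0 and at infinity
    determine the integral. *)
Lemma Gamma_primitive (R : realType) (a c : R) (P : R -> R) :
  (forall x : R, 0 < x -> is_derive x 1 P (x `^ (a - 1) * expR (- x))) ->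
  P x @[x --> 0^'+] --> 0 -> P x @[x --> +oo] --> c -> Gamma a = c.
Proof.
move=> dP P0 Pc; rewrite /Gamma /Rintegral.
rewrite (@ge0_FTC2_itv0y R _ P 0 c) ?subr0// => x x0.
  by rewrite mulr_ge0 ?powR_ge0 ?expR_ge0.
apply: continuousM.
  have := is_derive1_powR (a - 1) x0 => ?.
  by apply/differentiable_continuous/derivable1_diffP; exact: ex_derive.
apply: continuous_comp; first exact: opp_continuous.
exact: continuous_expR.
Qed.

(** Integration by parts, in the form of primitives: differentiating
    x ^ a * exp (- x) produces the integrands for a and for a + 1. *)
Lemma Gamma_primitiveS (R : realType) (a c : R) (P : R -> R) : 0 < a ->
  (forall x : R, 0 < x -> is_derive x 1 P (x `^ (a - 1) * expR (- x))) ->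
  P x @[x --> 0^'+] --> 0 -> P x @[x --> +oo] --> c ->
  let Q x := a * P x - x `^ a * expR (- x) in
  [/\ forall x : R, 0 < x -> is_derive x 1 Q (x `^ (a + 1 - 1) * expR (- x)),
      Q x @[x --> 0^'+] --> 0 & Q x @[x --> +oo] --> a * c].
Proof.
move=> a0 dP P0 Pc Q; split.
- move=> x x0; have dPx := dP x x0.
  have dpow := is_derive1_powR a x0.
  have dexp : is_derive x 1 (fun x => expR (- x)) (- expR (- x)).
    have h := is_derive1_comp (is_derive_expR (- x)) (is_deriveNid x 1).
    by apply: is_derive_eq; rewrite mulrN1.
  have h := is_deriveB (is_deriveZ a dPx) (is_deriveM dpow dexp).
  apply: is_derive_eq; rewrite /GRing.scale/= addrK; ring.
- rewrite -[X in _ --> X](subr0 0) -[X in _ --> X - _](mulr0 a).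
  apply: cvgB; first exact: cvgMr.
  rewrite -[X in _ --> X](mul0r (expR (- 0))); apply: cvgM.
    exact: powR_cvg0.
  apply: cvg_within_filter.
  apply: (@cvg_comp _ _ _ -%R expR); first exact: opp_continuous.
  exact: continuous_expR.
- rewrite -[X in _ --> X]subr0; apply: cvgB; first exact: cvgMr.
  exact: cvgy_powR_expRN.
Qed.

Lemma powRN12 (R : realType) (x : R) : 0 <= x ->
  x `^ (- 2^-1) = (Num.sqrt x)^-1.
Proof. by move=> x0; rewrite powRN powR12_sqrt. Qed.

(** The substitution s = x ^ 2, in the form of primitives: composing the
    Gaussian integral with the square root gives a primitive of the integrand of
    Gamma (1/2). *)
Lemma Gamma_half_primitive (R : realType) :
  let P (x : R) := 2 * integral0_gauss (Num.sqrt x) in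
  [/\ forall x : R, 0 < x -> is_derive x 1 P (x `^ (2^-1 - 1) * expR (- x)),
      P x @[x --> 0^'+] --> 0 & P x @[x --> +oo] --> Num.sqrt pi].
Proof.
move=> P; split.
- move=> x x0; have sx0 : 0 < Num.sqrt x by rewrite sqrtr_gt0.
  apply: is_derive_eq.
    apply: (is_deriveZ 2 (is_derive1_comp
      (is_derive_integral0_gauss _ _ sx0) (is_derive1_sqrt x0))).
  rewrite /GRing.scale/= /gauss_fun sqr_sqrtr ?ltW//.
  have -> : x `^ (2^-1 - 1) = (Num.sqrt x)^-1.
    rewrite (_ : 2^-1 - 1 = - 2^-1); last by lra.
    by rewrite powRN12// ltW.
  by field; rewrite gt_eqF.
- rewrite -[X in _ --> X](mulr0 2); apply: cvgMr.
  apply: cvg_within_filter.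
  apply: (@cvg_comp _ _ _ Num.sqrt); last exact: cvg0_integral0_gauss.
  by rewrite -{2}(@sqrtr0 R); exact: sqrt_continuous.
- rewrite (_ : Num.sqrt pi = 2 * (Num.sqrt pi / 2)); last by field.
  apply: cvgMr; apply: cvg_comp; last exact: cvgy_integral0_gauss.
  apply/cvgryPge => A; near=> x.
  rewrite (@le_trans _ _ `|A|) ?ler_norm// -sqrtr_sqr ler_wsqrtr//.
Unshelve. all: by end_near. Qed.

Lemma Gamma12 (R : realType) : Gamma 2^-1 = Num.sqrt pi :> R.
Proof. by have [] := Gamma_half_primitive R; exact: Gamma_primitive. Qed.

Lemma Gamma32 (R : realType) : Gamma (3 / 2) = Num.sqrt pi / 2 :> R.
Proof.
have [d c0 cy] := Gamma_half_primitive R.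
have [|d' c0' cy'] := Gamma_primitiveS _ _ _ _ _ d c0 cy.
  by rewrite invr_gt0.
rewrite [RHS]mulrC -(Gamma_primitive _ _ _ _ d' c0' cy'); congr Gamma; lra.
Qed.

Lemma Gamma52 (R : realType) : Gamma (5 / 2) = 3 / 4 * Num.sqrt pi :> R.
Proof.
have [d c0 cy] := Gamma_half_primitive R.
have [|d' c0' cy'] := Gamma_primitiveS _ _ _ _ _ d c0 cy.
  by rewrite invr_gt0.
have [|d2 c2 cy2] := Gamma_primitiveS _ _ _ _ _ d' c0' cy'.
  by rewrite addr_gt0// invr_gt0.
rewrite (_ : 3 / 4 * _ = (2^-1 + 1) * (2^-1 * Num.sqrt pi)); last by field.
rewrite -(Gamma_primitive _ _ _ _ d2 c2 cy2); congr Gamma; lra.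
Qed.

(** * The two Abel integrals *)

Lemma is_derive_subl (R : realType) (t s : R) :
  is_derive s 1 (fun s => t - s) (- 1).
Proof.
have h := is_deriveB (is_derive_cst t s 1) (is_derive_id s 1).
by apply: is_derive_eq; rewrite sub0r.
Qed.

(** If s = t (sin theta) ^ 2 then this is theta: it is the substitution that
    evaluates the Abel integrals, used here as a primitive. *)
Definition half_angle (R : realType) (t s : R) : R := atan (Num.sqrt (s / (t - s))).

Lemma is_derive_half_angle (R : realType) (t s : R) : s \in `]0, t[ ->
  is_derive s 1 (half_angle R t) (2 * Num.sqrt s * Num.sqrt (t - s))^-1.
Proof.
rewrite in_itv/= => /andP[s0 st]; have ts0 : 0 < t - s by rewrite subr_gt0.
have dts := is_derive_subl R t s.
have dV := @is_deriveV R (fun s => t - s) s _ 1 (lt0r_neq0 ts0) dts.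
have dq := is_deriveM (is_derive_id s 1) dV.
have q0 : 0 < s / (t - s) by rewrite divr_gt0.
have dw := @is_derive1_comp R Num.sqrt (fun s => s / (t - s)) s _ _
  (is_derive1_sqrt q0) dq.
have h := @is_derive1_comp R atan (fun s => Num.sqrt (s / (t - s))) s _ _
  (is_derive1_atan _) dw.
apply: is_derive_eq; rewrite /GRing.scale/= sqr_sqrtr ?(ltW q0)//.
rewrite sqrtrM ?(ltW s0)// sqrtrV ?(ltW ts0)//.
have a0 : 0 < Num.sqrt s by rewrite sqrtr_gt0.
have b0 : 0 < Num.sqrt (t - s) by rewrite sqrtr_gt0.
have := sqr_sqrtr (ltW s0); have := sqr_sqrtr (ltW ts0).
move: a0 b0 ts0; move: (Num.sqrt s) (Num.sqrt (t - s)) => a b a0 b0 ts0 bE aE.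
rewrite -bE -aE; field; rewrite !gt_eqF ?mulr_gt0 ?addr_gt0 ?exprn_gt0//.
Qed.

Lemma cvg0_half_angle (R : realType) (t : R) : 0 < t ->
  half_angle R t s @[s --> 0^'+] --> 0.
Proof.
move=> t0; apply: cvg_at_right_filter.
rewrite [X in _ --> X](_ : 0 = half_angle R t 0); last first.
  by rewrite /half_angle mul0r sqrtr0 atan0.
have h : {for 0, continuous (fun s : R => s / (t - s))}.
  apply: cvgM; first exact: cvg_id.
  apply: cvgV; first by rewrite subr0 gt_eqF.
  by apply: cvgB; [exact: cvg_cst|exact: cvg_id].
exact: (continuous_comp (continuous_comp h (@sqrt_continuous _ _))
  (@continuous_atan _ _)).
Qed.

Lemma cvgl_half_angle (R : realType) (t : R) : 0 < t ->
  half_angle R t s @[s --> t^'-] --> pi / 2.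
Proof.
move=> t0; apply: (@cvg_comp _ _ _ (fun s => Num.sqrt (s / (t - s))) atan);
  last exact: cvgy_atan.
apply/cvgryPge => A; near=> s.
have st : s < t by near: s; exact: nbhs_left_lt.
have s2 : t / 2 <= s.
  by near: s; apply: nbhs_left_ge; rewrite ltr_pdivrMr// ltr_pMr// ltr1n.
have sA : t - t / 2 / (1 + A ^+ 2) <= s.
  near: s; apply: nbhs_left_ge; rewrite ltrBlDr ltrDl divr_gt0// ?divr_gt0//.
  by rewrite ltr_pwDl// sqr_ge0.
have A1 : 0 < 1 + A ^+ 2 by rewrite ltr_pwDl// sqr_ge0.
have ts0 : 0 < t - s by rewrite subr_gt0.
rewrite (@le_trans _ _ `|A|) ?ler_norm// -sqrtr_sqr ler_wsqrtr//.
rewrite ler_pdivlMr//.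
have : (t - s) * (1 + A ^+ 2) <= t / 2.
  by rewrite -ler_pdivlMr// lerBlDr addrC -lerBlDr.
rewrite mulrDr mulr1 mulrC; lra.
Unshelve. all: by end_near. Qed.

Lemma continuous_sqrt_sub (R : realType) (t s : R) :
  {for s, continuous (fun s => Num.sqrt (t - s))}.
Proof.
apply: (@continuous_comp _ _ _ (fun s => t - s) Num.sqrt);
  last exact: sqrt_continuous.
by apply: cvgB; [exact: cvg_cst|exact: cvg_id].
Qed.

Lemma continuous_arcsine (R : realType) (t s : R) : s \in `]0, t[ ->
  {for s, continuous (fun s => (2 * Num.sqrt s * Num.sqrt (t - s))^-1)}.
Proof.
rewrite in_itv/= => /andP[s0 st].
apply: cvgV; first by rewrite !mulf_neq0// gt_eqF// sqrtr_gt0// subr_gt0.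
apply: cvgM; last exact: continuous_sqrt_sub.
by apply: cvgMr; exact: sqrt_continuous.
Qed.

Lemma continuous_sqrt_ratio (R : realType) (t s : R) : s \in `]0, t[ ->
  {for s, continuous (fun s => Num.sqrt s / Num.sqrt (t - s))}.
Proof.
rewrite in_itv/= => /andP[s0 st].
apply: cvgM; first exact: sqrt_continuous.
apply: cvgV; last exact: continuous_sqrt_sub.
by rewrite gt_eqF// sqrtr_gt0// subr_gt0.
Qed.

Lemma integral_arcsine (R : realType) (t : R) : 0 < t ->
  (\int[lebesgue_measure]_(s in `]0%R, t[)
     ((2 * Num.sqrt s * Num.sqrt (t - s))^-1)%:E = (pi / 2)%:E)%E.
Proof.
move=> t0; rewrite -[pi / 2]subr0.
apply: (ge0_FTC2_itv0 R t _ (half_angle R t) _ _ t0 _ (is_derive_half_angle R t)).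
- by move=> s _; rewrite invr_ge0 !mulr_ge0 ?sqrtr_ge0.
- exact: continuous_arcsine.
- exact: cvg0_half_angle.
- exact: cvgl_half_angle.
Qed.

Lemma integral_sqrt_ratio (R : realType) (t : R) : 0 < t ->
  (\int[lebesgue_measure]_(s in `]0%R, t[)
     (Num.sqrt s / Num.sqrt (t - s))%:E = (t * (pi / 2))%:E)%E.
Proof.
move=> t0; pose F s := t * half_angle R t s - Num.sqrt s * Num.sqrt (t - s).
have cG s : {for s, continuous (fun s => Num.sqrt s * Num.sqrt (t - s))}.
  by apply: cvgM; [exact: sqrt_continuous|exact: continuous_sqrt_sub].
have dF s : s \in `]0, t[ -> is_derive s 1 F (Num.sqrt s / Num.sqrt (t - s)).
  move=> st; have dh := is_derive_half_angle _ _ _ st.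
  move: st; rewrite in_itv/= => /andP[s0 st].
  have ts0 : 0 < t - s by rewrite subr_gt0.
  have dts := is_derive_subl R t s.
  have h := is_deriveB (is_deriveZ t dh) (is_deriveM (is_derive1_sqrt s0)
    (@is_derive1_comp R Num.sqrt (fun s => t - s) s _ _
      (is_derive1_sqrt ts0) dts)).
  apply: is_derive_eq; rewrite /GRing.scale/=.
  have a0 : 0 < Num.sqrt s by rewrite sqrtr_gt0.
  have b0 : 0 < Num.sqrt (t - s) by rewrite sqrtr_gt0.
  have tE : t = Num.sqrt s ^+ 2 + Num.sqrt (t - s) ^+ 2.
    by rewrite !sqr_sqrtr ?(ltW s0) ?(ltW ts0)//; ring.
  rewrite {1}tE; move: a0 b0; move: (Num.sqrt s) (Num.sqrt (t - s)) => a b a0 b0.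
  by field; rewrite !gt_eqF.
rewrite -[t * _]subr0; apply: (ge0_FTC2_itv0 R t _ F _ _ t0 _ dF).
- by move=> s _; rewrite divr_ge0 ?sqrtr_ge0.
- exact: continuous_sqrt_ratio.
- rewrite -[X in _ --> X](subr0 0) -[X in _ --> X - _](mulr0 t).
  apply: cvgB; first by apply: cvgMr; exact: cvg0_half_angle.
  apply: cvg_at_right_filter; have := cG 0.
  by rewrite /prop_for /continuous_at /= sqrtr0 mul0r.
- rewrite -[X in _ --> X]subr0.
  apply: cvgB; first by apply: cvgMr; exact: cvgl_half_angle.
  apply: cvg_at_left_filter; have := cG t.
  by rewrite /prop_for /continuous_at /= subrr sqrtr0 mulr0.
Qed.

Lemma ge0_integrable_itvoo (R : realType) (t : R) (f : R -> R) (l : R) :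
  (forall s : R, s \in `]0, t[ -> 0 <= f s) ->
  (forall s : R, s \in `]0, t[ -> {for s, continuous f}) ->
  (\int[lebesgue_measure]_(s in `]0%R, t[) (f s)%:E = l%:E)%E ->
  lebesgue_measure.-integrable `]0, t[ (EFin \o f).
Proof.
move=> f0 cf fl; apply/integrableP; split.
  apply/measurable_EFinP; apply: open_continuous_measurable_fun.
    exact: interval_open.
  by move=> s; rewrite inE; exact: cf.
apply: (@le_lt_trans _ _ l%:E); last by rewrite ltry.
rewrite -fl le_eqVlt; apply/predU1P; left; apply: eq_integral => s.
by rewrite inE/= => st; rewrite ger0_norm// f0.
Qed.

(** The kernel of the derivative of order 1/2 turns each component of the
    velocity of the curve into a combination of the two Abel integrands. The
    values of f at the ends 0 and t do not matter, since these points form a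
    null set. *)
Lemma integral_half_kernel (R : realType) (t c d : R) (f : R -> R) : 0 < t ->
  (forall s : R, s \in `]0, t[ -> f s =
     c * (2 * Num.sqrt s * Num.sqrt (t - s))^-1
     + d * (Num.sqrt s / Num.sqrt (t - s))) ->
  lebesgue_measure.-integrable `[0, t] (EFin \o f) /\
  \int[lebesgue_measure]_(s in `[0, t]) f s = c * (pi / 2) + d * (t * (pi / 2)).
Proof.
move=> t0 fE.
pose k0 s : R := (2 * Num.sqrt s * Num.sqrt (t - s))^-1.
pose k1 s : R := Num.sqrt s / Num.sqrt (t - s).
have ik0 : lebesgue_measure.-integrable `]0, t[ (EFin \o k0).
  apply: (ge0_integrable_itvoo _ _ _ _ _ _ (integral_arcsine R t t0)).
  - by move=> s _; rewrite invr_ge0 !mulr_ge0 ?sqrtr_ge0.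
  - exact: continuous_arcsine.
have ik1 : lebesgue_measure.-integrable `]0, t[ (EFin \o k1).
  apply: (ge0_integrable_itvoo _ _ _ _ _ _ (integral_sqrt_ratio R t t0)).
  - by move=> s _; rewrite divr_ge0 ?sqrtr_ge0.
  - exact: continuous_sqrt_ratio.
have ifoo : lebesgue_measure.-integrable `]0, t[ (EFin \o f).
  have mt : measurable (`]0, t[%classic : set (measurableTypeR R)) by [].
  have := integrableD mt (integrableZl mt c ik0) (integrableZl mt d ik1).
  by apply: eq_integrable => // s; rewrite inE/= => /fE ->; rewrite EFinD !EFinM.
have mf : measurable_fun `]0, t[ (EFin \o f) by case/integrableP: ifoo.
have mfcc : measurable_fun `[0, t] (EFin \o f).
  by apply/emeasurable_fun_itv_bndo_bndcP/emeasurable_fun_itv_obnd_cbndP.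
split.
  apply/integrableP; split=> //; rewrite integral_itv_bndoo.
    by case/integrableP: ifoo.
  exact: measurableT_comp.
transitivity (\int[lebesgue_measure]_(s in `]0, t[) (c * k0 s + d * k1 s)).
  rewrite /Rintegral integral_itv_bndoo//; congr fine.
  by apply: eq_integral => s; rewrite inE/= => /fE ->.
have mt : measurable (`]0, t[%classic : set (measurableTypeR R)) by [].
rewrite (RintegralD mt (integrableZl mt c ik0) (integrableZl mt d ik1)).
rewrite (RintegralZl c mt ik0) (RintegralZl d mt ik1).
by rewrite /Rintegral integral_arcsine// integral_sqrt_ratio.
Qed.

(** * Decimal bounds for pi *)

Definition atan_taylor (R : realType) (n : nat) (x : R) : R :=
  \sum_(i < n) (-1) ^+ i * x ^+ i.*2.+1 / i.*2.+1%:R.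

(** The derivative is a geometric sum of ratio - x ^ 2. *)
Lemma is_derive_atan_taylor (R : realType) (n : nat) (x : R) :
  is_derive x 1 (atan_taylor R n) ((1 - (- x ^+ 2) ^+ n) / (1 + x ^+ 2)).
Proof.
have x1 : 1 + x ^+ 2 != 0 by rewrite gt_eqF// ltr_pwDl// sqr_ge0.
rewrite [atan_taylor R n](_ : _ = \sum_(i < n)
    (fun x : R => (-1) ^+ i * x ^+ i.*2.+1 / i.*2.+1%:R)); last first.
  by apply/funext => y; rewrite fct_sumE.
apply: is_derive_eq.
  apply: is_derive_sum => i.
  instantiate (1 := fun i => (- x ^+ 2) ^+ i).
  rewrite (_ : (fun y : R => _) =
      ((-1) ^+ i / i.*2.+1%:R) \*: (id ^+ i.*2.+1)); last first.
    by apply/funext => y; rewrite /GRing.scale/= !fctE mulrAC.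
  apply: is_derive_eq; rewrite /GRing.scale/= mulr1 mulrA divfK ?pnatr_eq0//.
  by rewrite [in RHS]exprNn -exprM mul2n.
have := subrX1 (- x ^+ 2) n; set S := \sum_(i < n) _ => qS.
have -> : 1 - (- x ^+ 2) ^+ n = (1 + x ^+ 2) * S.
  by rewrite -opprB qS -mulNr opprB opprK.
by rewrite mulrAC divff// mul1r.
Qed.

(** The error atan - T_n vanishes at 0 and its derivative is
    (- x ^ 2) ^ n / (1 + x ^ 2), which has the sign of (-1) ^ n. *)
Lemma atan_taylor_alt (R : realType) (n : nat) (x : R) : 0 <= x ->
  0 <= (-1) ^+ n * (atan x - atan_taylor R n x).
Proof.
rewrite le_eqVlt => /predU1P[<-|x0].
  rewrite atan0 /atan_taylor big1 ?subr0 ?mulr0// => i _.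
  by rewrite expr0n mulr0 mul0r.
have dF (y : R) : is_derive y 1 (fun x => atan x - atan_taylor R n x)
    ((- y ^+ 2) ^+ n / (1 + y ^+ 2)).
  have y1 : 1 + y ^+ 2 != 0 by rewrite gt_eqF// ltr_pwDl// sqr_ge0.
  have h := is_deriveB (is_derive1_atan y) (is_derive_atan_taylor R n y).
  by apply: is_derive_eq; field.
have cF : {within `[0, x], continuous (fun x => atan x - atan_taylor R n x)}.
  by apply: derivable_within_continuous => y _; have := dF y => ?; exact: ex_derive.
have [c _] := MVT x0 (fun y _ => dF y) cF.
rewrite atan0 [atan_taylor R n 0] big1 ?subr0 => [|i _]; last first.
  by rewrite expr0n mulr0 mul0r.
move=> ->; rewrite (exprNn (c ^+ 2)) !mulrA -exprD addnn -mul2n exprM sqrrN.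
rewrite !expr1n mul1r.
apply: mulr_ge0 (ltW x0); apply: divr_ge0; first by rewrite exprn_ge0 ?sqr_ge0.
by rewrite addr_ge0 ?sqr_ge0.
Qed.

Lemma atan_lex (R : realType) (x : R) : 0 <= x -> atan x <= x.
Proof.
move=> x0; have := atan_taylor_alt R 1 x x0.
by rewrite /atan_taylor big_ord1 expr0 mul1r divr1 expr1 mulN1r oppr_ge0 subr_le0.
Qed.

(** Doubling the angle twice takes the tangent from 1/5 to 5/12 and to
    120/119, which is also the tangent of pi / 4 + atan (1/239). Both angles lie
    in [0, pi / 2[, where tan is injective; the rough bounds atan x <= x and
    2 <= pi are enough to place them there. *)
Lemma machin (R : realType) : pi / 4 = 4 * atan 5^-1 - atan 239^-1 :> R.
Proof.
have p2 := @pi_ge2 R.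
have a0 : 0 <= atan 5^-1 :> R.
  by rewrite -atan0; apply: le_atan; rewrite invr_ge0 ler0n.
have b0 : 0 <= atan 239^-1 :> R.
  by rewrite -atan0; apply: le_atan; rewrite invr_ge0 ler0n.
have a1 : atan 5^-1 <= 5^-1 :> R by apply: atan_lex; rewrite invr_ge0 ler0n.
have b1 : atan 239^-1 <= 239^-1 :> R.
  by apply: atan_lex; rewrite invr_ge0 ler0n.
have dom (x : R) : 0 <= x -> x < pi / 2 -> x \in `](- (pi / 2)), (pi / 2)[.
  by move=> *; rewrite in_itv/=; apply/andP; split; lra.
have cos_neq0 (x : R) : 0 <= x -> x < pi / 2 -> cos x != 0.
  move=> x0 x1; rewrite gt_eqF// cos_gt0_pihalf//.
  by have := dom x x0 x1; rewrite in_itv.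
have t2 : tan (atan 5^-1 *+ 2) = 5 / 12 :> R.
  rewrite tan_mulr2n ?atanK; last by apply: cos_neq0; lra.
  by field.
have t4 : tan (atan 5^-1 *+ 2 *+ 2) = 120 / 119 :> R.
  rewrite tan_mulr2n ?t2; last by apply: cos_neq0; lra.
  by field.
have tb : tan (atan 1 + atan 239^-1) = 120 / 119 :> R.
  rewrite tanD ?atanK; first by field.
    by rewrite atan1; apply: cos_neq0; lra.
  by apply: cos_neq0; lra.
suff : atan 5^-1 *+ 2 *+ 2 = atan 1 + atan 239^-1 :> R.
  by rewrite atan1 => h; lra.
apply: tan_inj; last by rewrite t4 tb.
  by apply: dom; lra.
by rewrite atan1; apply: dom; lra.
Qed.

Lemma pi_bounds (R : realType) :
  3 + 141 / 10 ^+ 3 + 592 / 10 ^+ 6 + 5 / 10 ^+ 7 <= (pi : R) <=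
    3 + 141 / 10 ^+ 3 + 592 / 10 ^+ 6 + 7 / 10 ^+ 7.
Proof.
have := machin R.
(* An odd number of terms bounds atan from above, an even number from below;
   the coefficient 16 of atan (1/5) in pi calls for more terms there. *)
have := atan_taylor_alt R 5 5^-1; have := atan_taylor_alt R 6 5^-1.
have := atan_taylor_alt R 1 239^-1; have := atan_taylor_alt R 2 239^-1.
rewrite !invr_ge0 /atan_taylor !big_ord_recr !big_ord0/= !(doubleS, double0).
move=> /(_ (ler0n _ _)) h1 /(_ (ler0n _ _)) h2.
move=> /(_ (ler0n _ _)) h3 /(_ (ler0n _ _)) h4 m.
lra.
Qed.

(** * The curve, its Caputo derivative and its energy *)

Lemma ord2_cases (i : 'I_2) : i = 0 \/ i = 1.
Proof. by case: i => [[|[|//]] i2]; [left|right]; exact: val_inj. Qed.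

Lemma curve00 (R : realType) (eps t : R) : curve eps t 0 0 = eps * Num.sqrt t.
Proof. by rewrite /curve mxE. Qed.

Lemma curve01 (R : realType) (eps t : R) : curve eps t 0 1 = Num.sqrt t * (1 - t).
Proof. by rewrite /curve mxE. Qed.

Lemma is_derive_curve0 (R : realType) (eps t : R) : 0 < t ->
  is_derive t 1 (fun s => curve eps s 0 0) (eps / (2 * Num.sqrt t)).
Proof.
move=> t0; rewrite (funext (curve00 R eps)).
by have h := is_deriveZ eps (is_derive1_sqrt t0); apply: is_derive_eq.
Qed.

Lemma is_derive_curve1 (R : realType) (eps t : R) : 0 < t ->
  is_derive t 1 (fun s => curve eps s 0 1) ((1 - 3 * t) / (2 * Num.sqrt t)).
Proof.
move=> t0; rewrite (funext (curve01 R eps)).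
have h := is_deriveM (is_derive1_sqrt t0)
  (is_deriveB (is_derive_cst (1 : R) t 1) (is_derive_id t 1)).
apply: is_derive_eq; rewrite /GRing.scale/= sub0r.
have := sqr_sqrtr (ltW t0); have : 0 < Num.sqrt t by rewrite sqrtr_gt0.
move: (Num.sqrt t) => r r0 <-.
by rewrite !fctE /cst/=; field; rewrite gt_eqF.
Qed.

Lemma derivable_curve (R : realType) (eps t : R) : 0 < t ->
  derivable (curve eps) t 1.
Proof.
move=> t0; apply/derivable_mxP => i j; rewrite (ord1 i).
have [h0 _] := is_derive_curve0 R eps t t0.
have [h1 _] := is_derive_curve1 R eps t t0.
have [->|->] := ord2_cases j; [exact: h0|exact: h1].
Qed.

Lemma derive1_curve0 (R : realType) (eps t : R) : 0 < t ->
  (curve eps)^`()%classic t 0 0 = eps / (2 * Num.sqrt t).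
Proof.
move=> t0; rewrite derive1E derive_mx ?mxE; last exact: derivable_curve.
by have [_ ->] := is_derive_curve0 R eps t t0.
Qed.

Lemma derive1_curve1 (R : realType) (eps t : R) : 0 < t ->
  (curve eps)^`()%classic t 0 1 = (1 - 3 * t) / (2 * Num.sqrt t).
Proof.
move=> t0; rewrite derive1E derive_mx ?mxE; last exact: derivable_curve.
by have [_ ->] := is_derive_curve1 R eps t t0.
Qed.

Lemma caputo_integral0 (R : realType) (eps t : R) : 0 < t ->
  lebesgue_measure.-integrable `[0, t]
    (EFin \o caputo_integrand (curve eps) t 0) /\
  \int[lebesgue_measure]_(s in `[0, t]) caputo_integrand (curve eps) t 0 s
    = eps * (pi / 2).
Proof.
move=> t0; rewrite -[eps * _]addr0 -[X in _ + X](mul0r (t * (pi / 2))).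
apply: integral_half_kernel => // s; rewrite in_itv/= => /andP[s0 st].
rewrite /caputo_integrand derive1_curve0// powRN12 ?subr_ge0 ?ltW//.
by field; rewrite !gt_eqF// sqrtr_gt0// subr_gt0.
Qed.

Lemma caputo_integral1 (R : realType) (eps t : R) : 0 < t ->
  lebesgue_measure.-integrable `[0, t]
    (EFin \o caputo_integrand (curve eps) t 1) /\
  \int[lebesgue_measure]_(s in `[0, t]) caputo_integrand (curve eps) t 1 s
    = (1 - 3 / 2 * t) * (pi / 2).
Proof.
move=> t0; rewrite (_ : (1 - _) * _ =
  1 * (pi / 2) + (- (3 / 2)) * (t * (pi / 2))); last by field.
apply: integral_half_kernel => // s; rewrite in_itv/= => /andP[s0 st].
rewrite /caputo_integrand derive1_curve1// powRN12 ?subr_ge0 ?ltW//.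
have := sqr_sqrtr (ltW s0); have : 0 < Num.sqrt s by rewrite sqrtr_gt0.
have : 0 < Num.sqrt (t - s) by rewrite sqrtr_gt0 subr_gt0.
move: (Num.sqrt s) (Num.sqrt (t - s)) => a b b0 a0 <-.
by field; rewrite !gt_eqF.
Qed.

Lemma integrable_caputo (R : realType) (eps t : R) (i : 'I_2) : 0 < t ->
  lebesgue_measure.-integrable `[0, t]
    (EFin \o caputo_integrand (curve eps) t i).
Proof.
move=> t0; have [->|->] := ord2_cases i.
  exact: (caputo_integral0 _ _ _ t0).1.
exact: (caputo_integral1 _ _ _ t0).1.
Qed.

Lemma is_derive_divr (R : realType) (c x : R) :
  is_derive x 1 (fun x => x / c) c^-1.
Proof.
have h := is_deriveM (is_derive_id x 1) (is_derive_cst c^-1 x 1).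
by apply: is_derive_eq; rewrite /GRing.scale/= mulr0 add0r mulr1.
Qed.

Lemma derive1_psi (R : realType) (eps x : R) : eps != 0 ->
  (psi eps)^`()%classic x = (1 - 3 * (x / eps) ^+ 2) / eps.
Proof.
move=> e0.
have dz := is_derive_divr R eps x.
have h := is_deriveB dz (is_deriveX 3 dz).
rewrite derive1E; apply: derive_val; apply: is_derive_eq.
rewrite /GRing.scale/=; field; exact: e0.
Qed.

(** B is chosen by [get], so its equation holds once some solution exists:
    the right-hand side is a polynomial, whose primitive is written down. *)
Lemma is_B_B (R : realType) (eps : R) : eps != 0 -> is_B eps (B eps).
Proof.
move=> e0; rewrite /B; apply: getPex.
pose g3 : R := Gamma (3 / 2); pose g5 : R := Gamma (5 / 2).
exists (fun x => - eps * g3 * x - (g3 * (x / eps) - (g5 / 3 + g3) * (x / eps) ^+ 3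
  + 3 / 5 * g5 * (x / eps) ^+ 5)); split.
  by rewrite mul0r; ring.
move=> x; have dz := is_derive_divr R eps x.
have h := is_deriveB (is_deriveZ (- eps * g3) (is_derive_id x 1))
  (is_deriveD
    (is_deriveB (is_deriveZ g3 dz) (is_deriveZ (g5 / 3 + g3) (is_deriveX 3 dz)))
    (is_deriveZ (3 / 5 * g5) (is_deriveX 5 dz))).
apply: is_derive_eq; rewrite derive1_psi// /Phi -/g3 -/g5 /GRing.scale/=.
field; exact: e0.
Qed.

(** The identity holds for t < 0 as well, where the square root is 0, so the
    two functions can be exchanged under a derivative. *)
Lemma energy_on_curveE (R : realType) (eps M t : R) : eps != 0 ->
  energy_on_curve eps M t = B eps (eps * Num.sqrt t).
Proof.
move=> e0; rewrite /energy_on_curve /energy curve00 curve01 /psi.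
rewrite mulrAC divff// mul1r.
have -> : Num.sqrt t * (1 - t) - (Num.sqrt t - Num.sqrt t ^+ 3) = 0.
  have [t0|/ltW/ler0_sqrtr ->] := leP 0 t; last by rewrite expr0n/=; ring.
  by rewrite exprS sqr_sqrtr//; ring.
by rewrite expr0n/= !mulr0 subr0 addr0.
Qed.

Lemma is_derive_energy_on_curve (R : realType) (eps M t : R) :
  eps != 0 -> 0 < t ->
  is_derive t 1 (energy_on_curve eps M)
    (Gamma (3 / 2) / (2 * Num.sqrt t) * (9 / 2 * t * (1 - t) - (1 + eps ^+ 2))).
Proof.
move=> e0 t0; rewrite (funext (fun t => energy_on_curveE R eps M t e0)).
have [_ dB] := is_B_B R eps e0.
have h := @is_derive1_comp R (B eps) (fun t => eps * Num.sqrt t) t _ _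
  (dB _) (is_deriveZ eps (is_derive1_sqrt t0)).
apply: is_derive_eq; rewrite derive1_psi// /Phi mulrAC divff// mul1r.
rewrite sqr_sqrtr ?(ltW t0)//.
rewrite Gamma52 Gamma32 /GRing.scale/=.
have r0 : 0 < Num.sqrt t by rewrite sqrtr_gt0.
by field; rewrite (gt_eqF r0) e0.
Qed.

Lemma caputo_dissipation (R : realType) (eps t : R) : 0 < t ->
  - inner (caputo_half (curve eps) t) ((curve eps)^`()%classic t) =
  Gamma (3 / 2) / (2 * Num.sqrt t) * (9 / 2 * t * (1 - t) - (1 + eps ^+ 2)).
Proof.
move=> t0; rewrite /inner big_ord_recl big_ord1.
rewrite (_ : lift ord0 ord0 = 1); last exact: val_inj.
rewrite derive1_curve0// derive1_curve1// !mxE.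
rewrite (caputo_integral0 _ _ _ t0).2 (caputo_integral1 _ _ _ t0).2 Gamma12 Gamma32.
have r0 : 0 < Num.sqrt t by rewrite sqrtr_gt0.
have p0 : 0 < Num.sqrt pi :> R by rewrite sqrtr_gt0 pi_gt0.
have := sqr_sqrtr (@pi_ge0 R); move: (Num.sqrt pi) p0 => p p0 <-.
by field; rewrite (gt_eqF r0) (gt_eqF p0).
Qed.

(** * The sign and the maximum of the energy rate *)

(** The closed form of the derivative of the energy along the curve. *)
Definition rate {R : realType} (eps t : R) : R :=
  Gamma (3 / 2) / (2 * Num.sqrt t) * (9 / 2 * t * (1 - t) - (1 + eps ^+ 2)).

Lemma Gamma32_gt0 (R : realType) : 0 < Gamma (3 / 2) :> R.
Proof. by rewrite Gamma32 divr_gt0// sqrtr_gt0 pi_gt0. Qed.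

(** If d <= 0 then both sides are false, because the square root is 0. *)
Lemma sqr_lt_sqrt (R : rcfType) (x d : R) : (x ^+ 2 < d) = (`|x| < Num.sqrt d).
Proof.
have [d0|d0] := ltP 0 d; first by rewrite -sqrtr_sqr ltr_sqrt.
rewrite ler0_sqrtr// normr_lt0.
by apply/negbTE; rewrite -leNgt (le_trans d0)// sqr_ge0.
Qed.

(** The threshold for eps is where the discriminant vanishes. *)
Lemma lt_inv_2sqrt2 (R : rcfType) (eps : R) : 0 < eps ->
  (eps < (2 * Num.sqrt 2)^-1) = (0 < 1 - 8 * (1 + eps ^+ 2) / 9).
Proof.
move=> e0; have s2 : 0 < (2 * Num.sqrt 2)^-1 :> R.
  by rewrite invr_gt0 mulr_gt0// sqrtr_gt0.
rewrite -ltr_sqr ?nnegrE ?(ltW e0) ?(ltW s2)// exprVn exprMn sqr_sqrtr//.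
by apply/idP/idP => h; lra.
Qed.

(** Up to a positive factor the rate is d - (2 t - 1) ^ 2 with d the
    discriminant. A negative d is covered: the interval is then empty and the
    rate is negative. *)
Lemma rate_gt0 (R : realType) (eps t : R) : 0 < t ->
  (0 < rate eps t) = (t \in `]t_minus eps, t_plus eps[).
Proof.
move=> t0; rewrite /rate pmulr_rgt0; last first.
  by rewrite divr_gt0 ?Gamma32_gt0// mulr_gt0// sqrtr_gt0.
pose d := 1 - 8 * (1 + eps ^+ 2) / 9.
rewrite (_ : (0 < _) = ((2 * t - 1) ^+ 2 < d)); last first.
  by rewrite /d; apply/idP/idP => h; nra.
rewrite sqr_lt_sqrt ltr_norml in_itv/= /t_minus /t_plus -/d.
by apply/idP/idP => /andP[h1 h2]; apply/andP; split; lra.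
Qed.

Lemma itv_t_minus_t_plus (R : realType) (eps : R) : 0 < eps ->
  `]t_minus eps, t_plus eps[%classic !=set0 <-> eps < (2 * Num.sqrt 2)^-1.
Proof.
move=> e0; rewrite lt_inv_2sqrt2// /t_minus /t_plus -sqrtr_gt0.
set q := Num.sqrt _; split=> [[x /=]|q0].
  by rewrite in_itv/= => /andP[h1 h2]; lra.
by exists 2^-1; rewrite /= in_itv/=; apply/andP; split; lra.
Qed.

Lemma t_star_eq (R : realType) (eps : R) :
  27 * t_star eps ^+ 2 - 9 * t_star eps = 2 * (1 + eps ^+ 2).
Proof.
have q2 : Num.sqrt (81 + 216 * (1 + eps ^+ 2)) ^+ 2 = 81 + 216 * (1 + eps ^+ 2).
  by apply: sqr_sqrtr; have := sqr_ge0 eps; lra.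
rewrite /t_star; move: q2; set q := Num.sqrt _ => q2.
rewrite (_ : 27 * _ - _ = (q ^+ 2 - 81) / 108); last by field.
by rewrite q2; field.
Qed.

Lemma t_star_ge (R : realType) (eps : R) : 1 / 3 <= t_star eps.
Proof.
have : 9 <= Num.sqrt (81 + 216 * (1 + eps ^+ 2)).
  rewrite -[9]ger0_norm// -sqrtr_sqr ler_wsqrtr//.
  have := sqr_ge0 eps; lra.
by rewrite /t_star => h; lra.
Qed.

(** The bound on eps comes from 45 ^ 2 = 81 + 216 * 9. *)
Lemma t_star_le1 (R : realType) (eps : R) : eps ^+ 2 <= 8 -> t_star eps <= 1.
Proof.
move=> e8; have : Num.sqrt (81 + 216 * (1 + eps ^+ 2)) <= 45.
  by rewrite -[45]ger0_norm// -sqrtr_sqr ler_wsqrtr//; lra.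
by rewrite /t_star => h; lra.
Qed.

(** As a function of r the left-hand side is Gamma (3/2) / 2 times
    9/2 r - 9/2 r ^ 3 - (1 + eps ^ 2) / r. The equation for t_star makes a
    a critical point of this function, which is why (r - a) ^ 2 divides the
    difference from its value at a. *)
Lemma rate_sqrt (R : realType) (eps a r : R) : a ^+ 2 = t_star eps -> 0 < r ->
  rate eps (r ^+ 2) = Gamma (3 / 2) / 2 * (9 * a - 18 * a ^+ 3)
    - Gamma (3 / 2) / 2 *
      (9 / 2 * (r - a) ^+ 2 * (r ^+ 2 + 2 * r * a + 3 * a ^+ 2 - 1) / r).
Proof.
move=> aE r0; rewrite /rate sqrtr_sqr gtr0_norm//.
have -> : 1 + eps ^+ 2 = (27 * a ^+ 4 - 9 * a ^+ 2) / 2.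
  by have := t_star_eq R eps; rewrite -aE -exprM => h; lra.
by field; rewrite gt_eqF.
Qed.

Lemma rate_t_star (R : realType) (eps : R) :
  rate eps (t_star eps) =
    Gamma (3 / 2) / 2 * (9 * Num.sqrt (t_star eps) * (1 - 2 * t_star eps)).
Proof.
have t0 : 0 < t_star eps by have := t_star_ge R eps; lra.
have aE := sqr_sqrtr (ltW t0).
rewrite -{1}aE (rate_sqrt _ _ _ _ aE) ?sqrtr_gt0// subrr expr0n/= mulr0.
rewrite !mul0r mulr0 subr0.
by move: (Num.sqrt _) aE => a <-; ring.
Qed.

Lemma rate_le_t_star (R : realType) (eps t : R) : 0 < t ->
  rate eps t <= rate eps (t_star eps).
Proof.
move=> t0; have t0' : 0 < t_star eps by have := t_star_ge R eps; lra.
have aE := sqr_sqrtr (ltW t0').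
have a0 : 0 < Num.sqrt (t_star eps) by rewrite sqrtr_gt0.
have r0 : 0 < Num.sqrt t by rewrite sqrtr_gt0.
rewrite -[in leLHS](sqr_sqrtr (ltW t0)) -{1}aE.
rewrite !(rate_sqrt _ _ _ _ aE)// subrr expr0n/= mulr0 !mul0r mulr0 subr0 gerBl.
apply: mulr_ge0; first by rewrite divr_ge0// ltW// Gamma32_gt0.
apply: divr_ge0; last exact: ltW.
apply: mulr_ge0; first by rewrite mulr_ge0// sqr_ge0.
have := t_star_ge R eps; rewrite aE => h.
have := sqr_ge0 (Num.sqrt t); have := mulr_gt0 r0 a0; lra.
Qed.

Lemma cvg_sqrt_disc (R : realType) :
  Num.sqrt (1 - 8 * (1 + eps ^+ 2) / 9) @[eps --> (0 : R)^'+] --> (1 / 3 : R).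
Proof.
rewrite (_ : 1 / 3 = Num.sqrt (1 - 8 * (1 + 0 ^+ 2) / 9)); last first.
  rewrite (_ : 1 - _ = (1 / 3) ^+ 2); last by rewrite expr0n/=; field.
  by rewrite sqrtr_sqr ger0_norm// divr_ge0.
apply: cvg_at_right_filter.
apply: (@cvg_comp _ _ _ (fun e : R => 1 - 8 * (1 + e ^+ 2) / 9) Num.sqrt);
  last exact: sqrt_continuous.
apply: cvgB; first exact: cvg_cst.
apply: cvgMl; apply: cvgMr; apply: cvgD; first exact: cvg_cst.
exact: exprn_continuous.
Qed.

Lemma cvg_t_minus (R : realType) :
  t_minus eps @[eps --> (0 : R)^'+] --> (1 / 3 : R).
Proof.
rewrite (_ : 1 / 3 = 2^-1 * (1 - 1 / 3)); last by field.
by apply: cvgMr; apply: cvgB; [exact: cvg_cst|exact: cvg_sqrt_disc].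
Qed.

Lemma cvg_t_plus (R : realType) : t_plus eps @[eps --> (0 : R)^'+] --> (2 / 3 : R).
Proof.
rewrite (_ : 2 / 3 = 2^-1 * (1 + 1 / 3)); last by field.
by apply: cvgMr; apply: cvgD; [exact: cvg_cst|exact: cvg_sqrt_disc].
Qed.

(** * Numerical values at one tenth *)

Lemma sqrt_bounds (R : rcfType) (a b x : R) : 0 <= a -> 0 <= b ->
  a ^+ 2 <= x -> x <= b ^+ 2 -> a <= Num.sqrt x <= b.
Proof.
move=> a0 b0 ax xb.
rewrite -[in a <= _](ger0_norm a0) -[in _ <= b](ger0_norm b0) -!sqrtr_sqr.
by rewrite !ler_wsqrtr.
Qed.

Lemma ler_pM_bounds (R : numDomainType) (a b x c d y : R) : 0 <= a -> 0 <= c ->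
  a <= x <= b -> c <= y <= d -> a * c <= x * y <= b * d.
Proof.
move=> a0 c0 /andP[ax xb] /andP[cy yd]; rewrite !ler_pM//.
  exact: le_trans ax.
exact: le_trans cy.
Qed.

Lemma sqrt_disc_bounds (R : realType) :
  319 / 10 ^+ 3 + 722 / 10 ^+ 6 + 10 / 10 ^+ 8
    <= (Num.sqrt (1 - 8 * (1 + 10^-1 ^+ 2) / 9) : R) <=
  319 / 10 ^+ 3 + 722 / 10 ^+ 6 + 11 / 10 ^+ 8.
Proof. by apply: sqrt_bounds; lra. Qed.

Lemma t_star_bounds (R : realType) :
  486 / 10 ^+ 3 + 967 / 10 ^+ 6 + 451 / 10 ^+ 9 + 23 / 10 ^+ 11
    <= t_star (10^-1 : R) <=
  486 / 10 ^+ 3 + 967 / 10 ^+ 6 + 451 / 10 ^+ 9 + 24 / 10 ^+ 11.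
Proof.
have : 17 + 296 / 10 ^+ 3 + 242 / 10 ^+ 6 + 366 / 10 ^+ 9 + 47 / 10 ^+ 11
    <= (Num.sqrt (81 + 216 * (1 + 10^-1 ^+ 2)) : R) <=
    17 + 296 / 10 ^+ 3 + 242 / 10 ^+ 6 + 366 / 10 ^+ 9 + 49 / 10 ^+ 11.
  by apply: sqrt_bounds; lra.
rewrite /t_star; move: (Num.sqrt _) => q /andP[q1 q2].
by apply/andP; split; lra.
Qed.

Lemma sqrt_t_star_bounds (R : realType) :
  697 / 10 ^+ 3 + 830 / 10 ^+ 6 + 531 / 10 ^+ 9
    <= Num.sqrt (t_star (10^-1 : R)) <=
  697 / 10 ^+ 3 + 830 / 10 ^+ 6 + 532 / 10 ^+ 9.
Proof.
have /andP[t1 t2] := t_star_bounds R.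
by apply: sqrt_bounds; lra.
Qed.

Lemma sqrt_pi_bounds (R : realType) :
  1 + 772 / 10 ^+ 3 + 453 / 10 ^+ 6 + 80 / 10 ^+ 8
    <= (Num.sqrt pi : R) <= 1 + 772 / 10 ^+ 3 + 453 / 10 ^+ 6 + 87 / 10 ^+ 8.
Proof.
have /andP[t1 t2] := pi_bounds R.
by apply: sqrt_bounds; lra.
Qed.

(** The factor 1 - 2 t_star is only about 0.026, so an error in t_star is
    amplified in relative size; this is the reason for the additional digits in
    [t_star_bounds]. *)
Lemma rate_t_star_bounds (R : realType) :
  72 / 10 ^+ 3 + 538 / 10 ^+ 6 + 196 / 10 ^+ 9
    <= rate (10^-1 : R) (t_star (10^-1 : R)) <=
  72 / 10 ^+ 3 + 538 / 10 ^+ 6 + 204 / 10 ^+ 9.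
Proof.
rewrite rate_t_star Gamma32.
have st := sqrt_t_star_bounds R; have sp := sqrt_pi_bounds R.
have t12 : 26 / 10 ^+ 3 + 65 / 10 ^+ 6 + 97 / 10 ^+ 9 + 52 / 10 ^+ 11
    <= 1 - 2 * t_star (10^-1 : R) <=
    26 / 10 ^+ 3 + 65 / 10 ^+ 6 + 97 / 10 ^+ 9 + 54 / 10 ^+ 11.
  by have /andP[t1 t2] := t_star_bounds R; apply/andP; split; lra.
have ad : 18 / 10 ^+ 3 + 189 / 10 ^+ 6 + 208 / 10 ^+ 10
    <= Num.sqrt (t_star (10^-1 : R)) * (1 - 2 * t_star (10^-1 : R)) <=
    18 / 10 ^+ 3 + 189 / 10 ^+ 6 + 209 / 10 ^+ 10.
  have h := ler_pM_bounds _ _ _ _ _ _ _ _ _ st t12.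
  have /andP[h1 h2] := h ltac:(lra) ltac:(lra).
  by apply/andP; split; lra.
have h := ler_pM_bounds _ _ _ _ _ _ _ _ _ sp ad.
have /andP[h1 h2] := h ltac:(lra) ltac:(lra).
by apply/andP; split; lra.
Qed.

Lemma rounds_t_minus (R : realType) :
  rounds_to (t_minus (10^-1 : R)) [:: 3; 4; 0; 1; 3; 8; 9; 5]%N.
Proof.
have /andP[h1 h2] := sqrt_disc_bounds R.
rewrite /rounds_to /decimal /t_minus !big_ord_recl big_ord0/= ler_norml.
by apply/andP; split; lra.
Qed.

Lemma rounds_t_plus (R : realType) :
  rounds_to (t_plus (10^-1 : R)) [:: 6; 5; 9; 8; 6; 1; 0; 5]%N.
Proof.
have /andP[h1 h2] := sqrt_disc_bounds R.
rewrite /rounds_to /decimal /t_plus !big_ord_recl big_ord0/= ler_norml.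
by apply/andP; split; lra.
Qed.

Lemma rounds_t_star (R : realType) :
  rounds_to (t_star (10^-1 : R)) [:: 4; 8; 6; 9; 6; 7; 4; 5]%N.
Proof.
have /andP[h1 h2] := t_star_bounds R.
rewrite /rounds_to /decimal !big_ord_recl big_ord0/= ler_norml.
by apply/andP; split; lra.
Qed.

Lemma rounds_rate_t_star (R : realType) :
  rounds_to (rate (10^-1 : R) (t_star (10^-1 : R))) [:: 0; 7; 2; 5; 3; 8; 2; 0]%N.
Proof.
have /andP[h1 h2] := rate_t_star_bounds R.
rewrite /rounds_to /decimal !big_ord_recl big_ord0/= ler_norml.
by apply/andP; split; lra.
Qed.

(** * The theorem *)

Lemma sup_image_max (R : realType) (T : Type) (A : set T) (f : T -> R) (a : T) :
  A a -> (forall x, A x -> f x <= f a) -> sup [set f x | x in A] = f a.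
Proof.
move=> Aa fa; have ubf : ubound [set f x | x in A] (f a).
  by move=> _ [x Ax <-]; exact: fa.
apply/eqP; rewrite eq_le; apply/andP; split.
  by apply: ge_sup => //; exists (f a), a.
by apply: ub_le_sup; [exists (f a)|exists a].
Qed.

Lemma derive1_energy_on_curve (R : realType) (eps M t : R) : eps != 0 -> 0 < t ->
  (energy_on_curve eps M)^`()%classic t = rate eps t.
Proof.
move=> e0 t0; have dE := is_derive_energy_on_curve R eps M t e0 t0.
by rewrite derive1E; exact: derive_val.
Qed.

Theorem theorem3p2 (R : realType) :
  [/\ forall eps M : R, 0 < eps -> eps < (2 * Num.sqrt 2)^-1 -> 0 < M ->
      [/\ forall t : R, 0 < t <= 1 ->
          [/\ derivable (curve eps) t 1,
              forall i : 'I_2, lebesgue_measure.-integrable `[0, t]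
                (EFin \o caputo_integrand (curve eps) t i),
              derivable (energy_on_curve eps M) t 1,
              (energy_on_curve eps M)^`()%classic t
                = - inner (caputo_half (curve eps) t) ((curve eps)^`()%classic t) &
              (energy_on_curve eps M)^`()%classic t
                = Gamma (3 / 2) / (2 * Num.sqrt t)
                  * (9 / 2 * t * (1 - t) - (1 + eps ^+ 2))],
          forall t : R, 0 < t <= 1 ->
            (0 < (energy_on_curve eps M)^`()%classic t
               <-> t \in `]t_minus eps, t_plus eps[) &
          0 < t_star eps <= 1 /\
          forall t : R, 0 < t <= 1 ->
            (energy_on_curve eps M)^`()%classic t
              <= (energy_on_curve eps M)^`()%classic (t_star eps)],
      forall eps : R, 0 < eps ->
        (`]t_minus eps, t_plus eps[%classic !=set0
           <-> eps < (2 * Num.sqrt 2)^-1),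
      forall M : R, 0 < M ->
        [/\ rounds_to (t_minus (10^-1 : R)) [:: 3; 4; 0; 1; 3; 8; 9; 5]%N,
            rounds_to (t_plus (10^-1 : R)) [:: 6; 5; 9; 8; 6; 1; 0; 5]%N,
            rounds_to (t_star (10^-1 : R)) [:: 4; 8; 6; 9; 6; 7; 4; 5]%N &
            rounds_to
              (sup [set (energy_on_curve 10^-1 M)^`()%classic t
                   | t in [set t : R | 0 < t <= 1]])
              [:: 0; 7; 2; 5; 3; 8; 2; 0]%N],
      t_minus eps @[eps --> (0 : R)^'+] --> (1 / 3 : R) &
      t_plus eps @[eps --> (0 : R)^'+] --> (2 / 3 : R)].
Proof.
split; [|exact: itv_t_minus_t_plus| |exact: cvg_t_minus|exact: cvg_t_plus].
- move=> eps M e0 ebound M0; have en0 : eps != 0 by rewrite gt_eqF.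
  have rateE t : 0 < t -> (energy_on_curve eps M)^`()%classic t = rate eps t.
    exact: derive1_energy_on_curve.
  have ts0 : 0 < t_star eps by have := t_star_ge R eps; lra.
  split.
  + move=> t /andP[t0 _]; split.
    * exact: derivable_curve.
    * by move=> i; exact: integrable_caputo.
    * by have dE := is_derive_energy_on_curve R eps M t en0 t0; exact: ex_derive.
    * by rewrite rateE// caputo_dissipation.
    * exact: rateE.
  + by move=> t /andP[t0 _]; rewrite rateE// rate_gt0.
  + split=> [|t /andP[t0 _]]; last by rewrite !rateE//; exact: rate_le_t_star.
    rewrite ts0 t_star_le1//.
    by move: ebound; rewrite lt_inv_2sqrt2// => h; lra.
- move=> M M0; split;
    [exact: rounds_t_minus|exact: rounds_t_plus|exact: rounds_t_star|].
  have e0 : 10^-1 != 0 :> R by rewrite gt_eqF// invr_gt0.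
  have ts0 : 0 < t_star (10^-1 : R) by have := t_star_ge R 10^-1; lra.
  rewrite (@sup_image_max _ _ _ _ (t_star 10^-1)).
  + by rewrite derive1_energy_on_curve//; exact: rounds_rate_t_star.
  + by rewrite /= ts0 t_star_le1//; lra.
  + move=> t /= /andP[t0 _]; rewrite !derive1_energy_on_curve//.
    exact: rate_le_t_star.
Qed.
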